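(* Let $S = [a,b] \subset \mathbb{R}$ with $a<b$ be a closed bounded interval, and let $F$ be a continuous cumulative distribution function of a probability distribution supported on $S$ (so $F(a)=0$ and $F(b)=1$) that is strictly increasing on $S$. Let $\mathcal{F}$ be the family of finite sigmoid mixtures defined in the context. Then for every $\epsilon > 0$ there exists a member $\hat{F} \in \mathcal{F}$ such that $$|\hat{F}(x) - F(x)| < \epsilon \quad \text{for all } x \in S.$$
   Context: Let $\sigma(t) = \frac{1}{1+e^{-t}}$ denote the (logistic) sigmoid function. The family $\mathcal{F}$ consists of all functions $\hat{F}_K : \mathbb{R} \to \mathbb{R}$ of the form $$\hat{F}_K(x) = \sum_{k=1}^K w_k\, \sigma\left( \frac{x - x_k}{h_k} \right),$$ where $K \in \mathbb{N}$ (with $K \ge 1$), and for $k=1,\dots,K$: $x_k \in \mathbb{R}$, $w_k \in \mathbb{R}_{>0}$, $h_k \in \mathbb{R}_{>0}$, subject to $\sum_{k=1}^K w_k = 1$. The number $K$ and all parameters $x_k, w_k, h_k$ may be chosen freely subject to these constraints. *)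

(* Defs.v *)
From HB Require Import structures.
From mathcomp Require Import all_boot all_order all_algebra.
From mathcomp Require Import all_classical all_reals all_analysis.

Set Implicit Arguments.
Unset Strict Implicit.
Unset Printing Implicit Defensive.
Import Order.TTheory GRing.Theory Num.Theory.
Import numFieldNormedType.Exports.

Local Open Scope classical_set_scope.
Local Open Scope ring_scope.

Definition sigmoid (R : realType) (t : R) : R := 1 / (1 + expR (- t)).

Definition sigmoid_mixture (R : realType) (K : nat) (x w h : 'I_K -> R) (t : R)
  : R := \sum_(k < K) w k * sigmoid ((t - x k) / h k).

Definition sigmoid_mixtures (R : realType) : set (R -> R) :=
  [set G | exists (K : nat) (x w h : 'I_K -> R),
    [/\ (0 < K)%N,
        forall k, 0 < w k,
        forall k, 0 < h k,
        \sum_(k < K) w k = 1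
      & G = sigmoid_mixture x w h]].

Arguments sigmoid_mixtures : clear implicits.

Definition idTR (R : realType) : measurableTypeR R -> R := idfun.

HB.instance Definition _ (R : realType) :=
  @isMeasurableFun.Build _ _ _ _ (@idTR R) (@measurable_id _ _ setT).

(* A law mu on the Borel line is the distribution of the identity random
   variable under mu; the library's cdf takes values in \bar R. *)
Definition is_cdf_of (R : realType) (mu : probability (measurableTypeR R) R)
    (F : R -> R) : Prop :=
  forall x : R, (F x)%:E = cdf (@idTR R : {RV mu >-> R}) x.

(* Main.v *)
Require Import Defs.
From HB Require Import structures.
From mathcomp Require Import all_boot all_order all_algebra.
From mathcomp Require Import all_classical all_reals all_analysis.
From mathcomp Require Import ring lra.
Set Implicit Arguments.
Unset Strict Implicit.
Unset Printing Implicit Defensive.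
Import Order.TTheory GRing.Theory Num.Theory.
Import numFieldNormedType.Exports.
Local Open Scope classical_set_scope.
Local Open Scope ring_scope.

(** Pick quantiles [q k] with [F (q k) = k / N], [k <= N], and give the same
weight [1 / N] to sigmoids centred at [q 0, ..., q (N - 1)], with a common
bandwidth far below the smallest gap between quantiles.  At [q j] the sigmoids
centred to the left are almost [1] and those to the right almost [0], so the
mixture is within [1 / N + e] of [F] there.  Since the mixture and [F] are both
nondecreasing, closeness at the quantiles propagates to the whole interval. *)

Lemma sigmoid_ge0 (R : realType) (t : R) : 0 <= sigmoid t.
Proof. by rewrite /sigmoid divr_ge0// addr_ge0// expR_ge0. Qed.

Lemma sigmoidN (R : realType) (t : R) : sigmoid (- t) = 1 - sigmoid t.
Proof.
rewrite /sigmoid opprK expRN; have := expR_gt0 t.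
move: (expR t) => u u0; field.
by apply/andP; split; lra.
Qed.

Lemma sigmoid_le1 (R : realType) (t : R) : sigmoid t <= 1.
Proof. by have := sigmoid_ge0 (- t); rewrite sigmoidN subr_ge0. Qed.

Lemma sigmoid_nondecreasing (R : realType) : {homo @sigmoid R : s t / s <= t}.
Proof.
move=> s t st; rewrite /sigmoid !div1r lef_pV2 ?posrE ?addr_gt0 ?expR_gt0//.
by rewrite lerD2l ler_expR lerN2.
Qed.

(** The tangent bound [1 + u <= expR u] at [u = - t] already gives [e^-1 <= 1 + expR (- t)]. This
    linear rate is crude but enough, since the bandwidth can be taken as small as desired. *)
Lemma sigmoid_tail (R : realType) (e t : R) :
  0 < e -> t <= - e^-1 -> sigmoid t <= e.
Proof.
move=> e0 te; rewrite /sigmoid div1r -[leRHS]invrK.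
rewrite lef_pV2 ?posrE ?invr_gt0 ?addr_gt0 ?expR_gt0//.
by have := expR_ge1Dx (- t); lra.
Qed.

Lemma sigmoid_mixture_nondecreasing (R : realType) (K : nat)
    (x w h : 'I_K -> R) :
  (forall k, 0 <= w k) -> (forall k, 0 < h k) ->
  {homo sigmoid_mixture x w h : s t / s <= t}.
Proof.
move=> w0 h0 s t st; apply: ler_sum => k _; apply: ler_wpM2l => //.
by apply: sigmoid_nondecreasing; rewrite ler_pM2r ?invr_gt0// lerD2r.
Qed.

(** Only consecutive gaps matter, so the induction takes the minimum of the old bound and the newest
    gap. A uniform [d] lets all sigmoids share one bandwidth. *)
Lemma increasing_gap (R : realType) (q : nat -> R) (n : nat) :
  (forall i j, (i < j <= n)%N -> q i < q j) ->
  exists2 d : R, 0 < d & forall i j, (i < j <= n)%N -> q i + d <= q j.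
Proof.
elim: n => [|n IH] qlt.
  by exists 1 => // i j /andP[ij]; rewrite leqn0 => /eqP j0; rewrite j0 in ij.
have [|d d0 dP] := IH.
  by move=> i j /andP[ij jn]; rewrite qlt// ij leqW.
have qn : q n < q n.+1 by apply: qlt; rewrite !leqnn.
exists (Num.min d (q n.+1 - q n)).
  by rewrite lt_min d0 subr_gt0.
move=> i j /andP[ij]; rewrite leq_eqVlt => /orP[/eqP jn|].
  have qin : q i <= q n.
    move: ij; rewrite jn ltnS leq_eqVlt => /orP[/eqP->//|ij].
    by rewrite ltW// qlt// ij leqnSn.
  have : Num.min d (q n.+1 - q n) <= q n.+1 - q n by rewrite ge_min lexx orbT.
  by rewrite jn; lra.
rewrite ltnS => jn.
have : Num.min d (q n.+1 - q n) <= d by rewrite ge_min lexx.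
have := dP i j; rewrite ij jn => /(_ isT); lra.
Qed.

Lemma sum_nat_lt (R : pzSemiRingType) (n j : nat) :
  \sum_(k < n) (k < j)%N%:R = (minn j n)%:R :> R.
Proof.
elim: n => [|n IH]; first by rewrite big_ord0 minn0.
rewrite big_ord_recr/= IH -natrD; congr (_%:R).
by have [nj|jn] := ltnP n j;
  rewrite ?(minn_idPr nj) ?(minn_idPl (leqW jn)) ?addn1 ?addn0.
Qed.

(** Up to an error [e], the sigmoid centred at [q k] acts at [q j] as the indicator of [k < j]. The
    summand [k = j] is only known to lie in [[0, 1]], hence [j] in the lower bound and [j.+1] in the
    upper one. *)
Lemma mixture_at_knot (R : realType) (q : nat -> R) (N j : nat) (d e : R) :
  0 < d -> 0 < e -> (forall i k, (i < k <= N)%N -> q i + d <= q k) ->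
  (0 < N)%N -> (j <= N)%N ->
  j%:R / N%:R - e
    <= sigmoid_mixture (fun k : 'I_N => q k) (fun=> N%:R^-1) (fun=> d * e) (q j)
    <= j.+1%:R / N%:R + e.
Proof.
move=> d0 e0 gap N0 jN.
have de0 : 0 < d * e by rewrite mulr_gt0.
have Np : 0 < N%:R :> R by rewrite ltr0n.
(* Dividing a gap of at least [d] by the bandwidth [d * e] gives at least [e^-1], the threshold of
   [sigmoid_tail]. *)
have left_tail (k : 'I_N) : (k < j)%N -> 1 - e <= sigmoid ((q j - q k) / (d * e)).
  move=> kj; rewrite lerBlDr -lerBlDl -sigmoidN sigmoid_tail// lerN2.
  rewrite ler_pdivlMr// mulrCA mulVf ?gt_eqF// mulr1.
  by have := gap k j; rewrite kj jN => /(_ isT); lra.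
have right_tail (k : 'I_N) : (j < k)%N -> sigmoid ((q j - q k) / (d * e)) <= e.
  move=> jk; rewrite sigmoid_tail//.
  rewrite ler_pdivrMr// mulNr mulrCA mulVf ?gt_eqF// mulr1.
  by have := gap j k; rewrite jk (ltnW (ltn_ord k)) => /(_ isT); lra.
have sume : \sum_(k < N) e = N%:R * e.
  by rewrite sumr_const card_ord mulr_natl.
rewrite /sigmoid_mixture -mulr_sumr mulrC [X in _ <= X <= _]mulrC.
apply/andP; split.
  rewrite ler_pdivlMr// mulrBl mulrAC mulVf ?gt_eqF// mul1r.
  have <- : \sum_(k < N) ((k < j)%N%:R - e) = j%:R - e * N%:R.
    by rewrite big_split/= sum_nat_lt sumrN sume (minn_idPl jN) mulrC.
  apply: ler_sum => k _; case: ltnP => [/left_tail//|_].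
  by rewrite sub0r; have := sigmoid_ge0 ((q j - q k) / (d * e)); lra.
rewrite ler_pdivrMr// mulrDl mulfVK ?gt_eqF//.
(* No sigmoid is centred at [q N], so for [j = N] the count stops at [N]. *)
have jle : (minn j.+1 N)%:R <= j.+1%:R :> R by rewrite ler_nat geq_minl.
apply: (@le_trans _ _ (\sum_(k < N) ((k < j.+1)%N%:R + e))).
  apply: ler_sum => k _; case: ltnP => [_|/right_tail].
    by rewrite mulr1n; have := sigmoid_le1 ((q j - q k) / (d * e)); lra.
  by rewrite add0r.
by rewrite big_split/= sum_nat_lt sume; lra.
Qed.

Lemma uniform_mixture_close (R : realType) (a b : R) (F : R -> R) (eps : R) :
  a < b -> {within `[a, b], continuous F} -> F a = 0 -> F b = 1 ->
  {in `[a, b] &, {homo F : x y / x < y}} -> 0 < eps ->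
  exists2 G : R -> R, sigmoid_mixtures R G &
    forall x : R, x \in `[a, b] -> `|G x - F x| < eps.
Proof.
move=> ab Fcont Fa Fb Fincr eps0.
have Fle x y : x \in `[a, b] -> y \in `[a, b] -> x <= y -> F x <= F y.
  move=> xab yab; rewrite le_eqVlt => /orP[/eqP->//|xy].
  exact/ltW/Fincr.
have leF x y : x \in `[a, b] -> y \in `[a, b] -> F x <= F y -> x <= y.
  by move=> xab yab; apply: contraTT; rewrite -!ltNge => /Fincr; exact.
have aab : a \in `[a, b] by rewrite in_itv/= lexx ltW.
have bab : b \in `[a, b] by rewrite in_itv/= lexx andbT ltW.
(* Since [N%:R^-1 < e], the final error is at most [2 / N + e < 3 * e < eps]. *)
pose e := eps / 4.
have e0 : 0 < e by rewrite /e; lra.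
pose N := (Num.truncn e^-1).+1.
have Np : 0 < N%:R :> R by rewrite ltr0n.
have Ne : N%:R^-1 < e.
  rewrite -[ltRHS]invrK ltf_pV2 ?posrE ?invr_gt0//.
  exact: truncnS_gt.
(* Quantiles come from the intermediate value theorem; beyond [N] the value of [q] is arbitrary. *)
have /choice[q qP] : forall k : nat, exists c : R,
    (k <= N)%N -> c \in `[a, b] /\ F c = k%:R / N%:R.
  move=> k; have [kN|kN] := leqP k N; last by exists 0.
  have [|c cab Fc] := @IVT R F a b (k%:R / N%:R) (ltW ab) Fcont.
    rewrite Fa Fb (min_idPl _)// (max_idPr _)// divr_ge0//=.
    by rewrite ler_pdivrMr// mul1r ler_nat.
  by exists c.
have qlt i j : (i < j <= N)%N -> q i < q j.
  move=> /andP[ij jN]; have [qi Fi] := qP i (leq_trans (ltnW ij) jN).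
  have [qj Fj] := qP j jN; rewrite ltNge; apply/negP => /(Fle _ _ qj qi).
  by rewrite Fi Fj leNgt ltr_pM2r ?invr_gt0// ltr_nat ij.
have [d d0 gap] := increasing_gap qlt.
pose G := sigmoid_mixture (fun k : 'I_N => q k) (fun=> N%:R^-1) (fun=> d * e).
have Gle : {homo G : x y / x <= y}.
  apply: sigmoid_mixture_nondecreasing => _; last exact: mulr_gt0.
  by rewrite invr_ge0 ltW.
exists G.
  exists N, (fun k => q k), (fun=> N%:R^-1), (fun=> d * e); split => //.
  - by move=> _; rewrite invr_gt0.
  - by move=> _; rewrite mulr_gt0.
  - by rewrite sumr_const card_ord -[LHS]mulr_natl divff// gt_eqF.
move=> x xab.
(* Take the least [m] satisfying the upper bound: minimality yields the lower bound, with [F a = 0]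
   covering [m = 0], and [F b = 1] gives [m < N]. *)
have [m mN /andP[mF Fm]] : exists2 m, (m < N)%N &
    m%:R / N%:R <= F x <= m.+1%:R / N%:R.
  have ex : exists m, F x <= m.+1%:R / N%:R.
    exists N.-1; rewrite prednK// divff ?gt_eqF// -Fb Fle//.
    by move: xab; rewrite in_itv => /andP[].
  case: (ex_minnP ex) => m Fm mmin; exists m.
    rewrite -[N]prednK// ltnS; apply: mmin.
    rewrite prednK// divff ?gt_eqF// -Fb Fle//.
    by move: xab; rewrite in_itv => /andP[].
  rewrite Fm andbT; case: m {Fm} mmin => [_|m mmin].
    by rewrite mul0r -Fa Fle//; move: xab; rewrite in_itv => /andP[].
  by rewrite leNgt; apply/negP => /ltW/mmin; rewrite ltnn.
have [qm Fqm] := qP m (ltnW mN); have [qm1 Fqm1] := qP m.+1 mN.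
(* Strict monotonicity makes [F] reflect the order, so bracketing [F x] brackets [x] between [q m]
   and [q m.+1]. *)
have Glow : G (q m) <= G x by rewrite Gle// leF// Fqm.
have Gupp : G x <= G (q m.+1) by rewrite Gle// leF// Fqm1.
have /andP[low _] := mixture_at_knot d0 e0 gap (ltn0Sn _) (ltnW mN).
have /andP[_ upp] := mixture_at_knot d0 e0 gap (ltn0Sn _) mN.
rewrite -/N -/G in low upp.
have S1 : m.+1%:R / N%:R = m%:R / N%:R + N%:R^-1 :> R.
  by rewrite -natr1 mulrDl mul1r.
have S2 : m.+2%:R / N%:R = m.+1%:R / N%:R + N%:R^-1 :> R.
  by rewrite -[m.+2%:R]natr1 mulrDl mul1r.
have e4 : eps = 4 * e by rewrite /e; field.
by rewrite ltr_norml; apply/andP; split; lra.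
Qed.

Lemma is_cdf_ofE (R : realType) (mu : probability (measurableTypeR R) R)
    (F : R -> R) :
  is_cdf_of mu F -> forall x, (F x)%:E = mu `]-oo, x]%classic.
Proof. by move=> hF x; rewrite hF. Qed.

Lemma cdf_right_endpoint (R : realType) (a b : R)
    (mu : probability (measurableTypeR R) R) (F : R -> R) :
  is_cdf_of mu F -> mu `[a, b]%classic = 1%E -> F b = 1.
Proof.
move=> /is_cdf_ofE hF mu1; apply/eqP; rewrite -eqe hF eq_le.
rewrite probability_le1//= -mu1 le_measure ?inE//.
by move=> x /=; rewrite !in_itv/= => /andP[].
Qed.

(** All mass lies in [[a, b]], so [F] vanishes to the left of [a]; continuity at [a] rules out an
    atom there by identifying [F a] with the left limit. *)
Lemma cdf_left_endpoint (R : realType) (a b : R)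
    (mu : probability (measurableTypeR R) R) (F : R -> R) :
  is_cdf_of mu F -> mu `[a, b]%classic = 1%E -> {for a, continuous F} -> F a = 0.
Proof.
move=> /is_cdf_ofE hF mu1 Fa.
have F0 x : x < a -> F x = 0.
  move=> xa; apply/eqP; rewrite -eqe hF -measure_le0.
  have <- : mu (~` `[a, b]%classic) = 0%E by rewrite probability_setC// mu1 subee.
  rewrite le_measure ?inE//; first exact: measurableC.
  move=> y /=; rewrite !in_itv/= => yx; apply/negP; rewrite negb_and -ltNge.
  by rewrite (le_lt_trans yx xa).
have cvg0 : F x @[x --> a^'-] --> (0 : R).
  by apply: cvg_near_cst; near=> x; apply: F0; near: x; exact: nbhs_left_lt.
by apply: cvg_unique (cvg_at_left_filter Fa) cvg0; exact: Rhausdorff.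
Unshelve. all: by end_near. Qed.

Theorem theorem1 (R : realType) (a b : R) (hab : a < b)
    (mu : probability (measurableTypeR R) R) (F : R -> R)
    (hF : is_cdf_of mu F)
    (hsupp : mu `[a, b]%classic = 1%E)
    (hcont : continuous F)
    (hincr : {in `[a, b] &, {homo F : x y / x < y}})
    (eps : R) (heps : 0 < eps) :
  exists2 G : R -> R, sigmoid_mixtures R G &
    forall x : R, x \in `[a, b] -> `|G x - F x| < eps.
Proof.
apply: uniform_mixture_close hab _ _ _ hincr heps.
- exact: continuous_subspaceT.
- exact: cdf_left_endpoint hF hsupp (hcont a).
- exact: cdf_right_endpoint hF hsupp.
Qed.
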